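(* Let $G$ be a bicyclic graph with minimum degree $\delta(G)>1$. Then $G$ has exactly two main signless Laplacian eigenvalues if and only if $G$ is isomorphic to one of the following seven graphs: (1) two triangles sharing exactly one vertex; (2) two vertex-disjoint triangles joined by a single edge between a vertex of one and a vertex of the other; (3) two vertex-disjoint triangles joined by a path of length $3$ between a vertex of one and a vertex of the other (the two internal vertices of the path having degree $2$); (4)–(7) the theta graphs consisting of two vertices $u,v$ joined by three internally vertex-disjoint paths whose lengths are, respectively, $(2,2,1)$, $(3,3,1)$, $(2,2,2)$ and $(3,3,3)$.
   Context: All graphs are finite, simple and connected. A bicyclic graph is a simple connected graph whose number of edges equals its number of vertices plus one. For a graph $G$ with degree matrix $D$ and adjacency matrix $A$, the signless Laplacian is $L^+=D+A$. An eigenvalue $\mu$ of $L^+$ is a main signless Laplacian eigenvalue of $G$ if its eigenspace is not orthogonal to the all-ones vector, i.e. it has an eigenvector whose entries have nonzero sum. The length of a path is its number of edges. *)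

(* Defs.v *)
From mathcomp Require Import all_boot all_order all_algebra.
From mathcomp Require Import reals.

Set Implicit Arguments.
Unset Strict Implicit.
Unset Printing Implicit Defensive.

Import GRing.Theory.

Record sgraph := SGraph {
  svertex :> finType;
  sedge : rel svertex;
  sedge_sym : symmetric sedge;
  sedge_irrefl : irreflexive sedge }.

Definition edges (G : sgraph) : {set {set G}} :=
  [set [set x; y] | x in G, y in G & sedge x y].

Definition connected (G : sgraph) : Prop :=
  forall x y : G, connect (@sedge G) x y.

(* The edge count forces #|G| > 0. *)
Definition bicyclic (G : sgraph) : Prop :=
  connected G /\ #|edges G| = #|G|.+1.

Definition deg (G : sgraph) (x : G) : nat := #|[set y | sedge x y]|.

(* The default value #|G| exceeds every degree, so it only matters when G is
   empty. *)
Definition min_degree (G : sgraph) : nat := \big[minn/#|G|]_(x : G) deg x.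

Definition iso (G H : sgraph) : Prop :=
  exists f : G -> H,
    bijective f /\ forall x y : G, sedge (f x) (f y) = sedge x y.

Section Spectrum.
Local Open Scope ring_scope.
Variables (R : realType) (G : sgraph).

Definition adj_mx : 'M[R]_#|G| :=
  \matrix_(i, j) (sedge (enum_val i : G) (enum_val j))%:R.

Definition deg_mx : 'M[R]_#|G| := diag_mx (\row_i (deg (enum_val i : G))%:R).

Definition signless_laplacian : 'M[R]_#|G| := deg_mx + adj_mx.

(* Library eigenvectors are row vectors; the matrix is symmetric, so these are
   the transposes of the usual ones. *)
Definition main_signless_eigenvalue (mu : R) : Prop :=
  eigenvalue signless_laplacian mu /\
  exists2 v : 'rV[R]_#|G|,
    (v <= eigenspace signless_laplacian mu)%MS & \sum_i v 0 i != 0.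

Definition exactly_two_main_signless_eigenvalues : Prop :=
  exists mu1 mu2 : R, mu1 != mu2 /\
    forall mu : R, main_signless_eigenvalue mu <-> mu = mu1 \/ mu = mu2.

End Spectrum.

Section EdgeListGraph.
Variables (n : nat) (s : seq (nat * nat)).

Definition edge_list_rel : rel 'I_n := fun x y =>
  (x != y) && (((x : nat, y : nat) \in s) || ((y : nat, x : nat) \in s)).

Lemma edge_list_sym : symmetric edge_list_rel.
Proof. by move=> x y; rewrite /edge_list_rel eq_sym orbC. Qed.

Lemma edge_list_irrefl : irreflexive edge_list_rel.
Proof. by move=> x; rewrite /edge_list_rel eqxx. Qed.

Definition edge_list_graph : sgraph := SGraph edge_list_sym edge_list_irrefl.

End EdgeListGraph.

(* The path u, k, k+1, ..., k+l-2, v of length l > 0. *)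
Definition path_edges (u v k l : nat) : seq (nat * nat) :=
  zip (u :: iota k l.-1) (rcons (iota k l.-1) v).

Definition triangle_edges (a b c : nat) : seq (nat * nat) :=
  [:: (a, b); (b, c); (c, a)].

Definition bowtie : sgraph :=
  edge_list_graph 5 (triangle_edges 0 1 2 ++ triangle_edges 0 3 4).

(* For l > 0: triangles on 0, 1, 2 and on 3, 4, 5; the path of length l joins
   0 to 3 through 6, ..., l + 4. *)
Definition dumbbell (l : nat) : sgraph :=
  edge_list_graph (l + 5)
    (triangle_edges 0 1 2 ++ triangle_edges 3 4 5 ++ path_edges 0 3 6 l).

(* For a, b, c > 0, at most one of them equal to 1: three paths from 0 to 1
   with internal vertices 2, ..., a, then a + 1, ..., a + b - 1, then
   a + b, ..., a + b + c - 2. *)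
Definition theta (a b c : nat) : sgraph :=
  edge_list_graph (a + b + c).-1
    (path_edges 0 1 2 a ++ path_edges 0 1 a.+1 b ++ path_edges 0 1 (a + b) c).

(* Main.v *)
Require Import Defs.
From mathcomp Require Import all_boot all_order all_algebra.
From mathcomp Require Import reals.
From mathcomp Require Import complex ring zify.

(** Let Q be the signless Laplacian, e the all-ones vector and d = Q e / 2 the
    degree vector. A real symmetric matrix is diagonalizable, so e is a sum of
    nonzero pairwise orthogonal eigenvectors, one for each main eigenvalue.
    Hence there are exactly two of them iff Q^2 e is a combination of Q e and e
    while e is not an eigenvector, i.e. iff d is not constant and
    d(x)^2 + (sum of d over the neighbours of x) is an affine function of d(x).

    In a bicyclic graph of minimum degree at least 2 the excesses d(x) - 2 sum
    to 2, so either one vertex has degree 4, or two vertices p, q have degree 3,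
    all others having degree 2. As only two degrees occur, the condition says
    that the sum of the neighbours' degrees depends on d(x) only. With a vertex
    of degree 4 this makes all vertices adjacent to it. Otherwise every vertex
    of degree 2 has the same number c > 0 of neighbours among p, q; c = 2 gives
    theta(2,2,1) and theta(2,2,2), and for c = 1 the vertices of degree 2 are
    perfectly matched, whence the other four graphs. *)

Set Implicit Arguments.
Unset Strict Implicit.
Unset Printing Implicit Defensive.

Import Order.TTheory GRing.Theory Num.Theory.

(** * Main eigenvalues of a real symmetric matrix *)

Section SymmetricMatrix.
Local Open Scope ring_scope.
Variable R : rcfType.

(** Over the complex numbers the matrix is hermitian, so the spectral theorem gives a minimal
    polynomial with simple roots, all of them real. The same product of linear factors, taken over
    [R], annihilates [A], because mapping to complex matrices is injective. *)
Lemma symmetric_diagonalizable n (A : 'M[R]_n) : A^T = A -> diagonalizable A.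
Proof.
case: n A => [|n] A symA.
  by rewrite [A]flatmx0; apply: diagonalizable0.
pose toC := real_complex R; pose B := map_mx toC A.
have hermB : B \is hermsymmx.
  apply: realsym_hermsym.
    by apply/is_hermitianmxP; rewrite expr0 scale1r map_mx_id // /B map_trmx symA.
  by apply/mxOverP => i j; rewrite mxE complex_real.
have normB := hermitian_normalmx hermB.
have realD := hermitian_spectral_diag_real hermB.
have /orthomx_spectralP defB := normB.
have unitP := spectral_unit B.
set P := spectralmx B in defB unitP; set D := spectral_diag B in defB realD.
have conjB : conjmx P B = diag_mx D by rewrite defB -conjVmx // conjmxVK.
have diagB : similar_diag P B by rewrite /similar_to conjB diag_mx_is_diag.
have minB := similar_diag_mxminpoly unitP diagB.
set rs := undup _ in minB.
have real_rs r : r \in rs -> toC (complex.Re r) = r.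
  rewrite mem_undup => /mapP[i _ ->]; apply: RRe_real.
  by rewrite conjB mxE eqxx mulr1n; apply: (mxOverP realD).
apply/diagonalizableP; exists (map (@complex.Re R) rs).
  rewrite map_inj_in_uniq ?undup_uniq // => x y xs ys eqxy.
  by rewrite -(real_rs x) // -(real_rs y) // eqxy.
apply: mxminpoly_min; apply: (map_mx_inj (f := real_complex R)).
rewrite map_horner_mx rmorph_prod /= map_mx0.
apply/mxminpoly_minP; rewrite -/toC -/B minB big_map.
rewrite [X in _ %| X](eq_big_seq (fun r => 'X - r%:P)) // => r rrs.
by rewrite map_polyXsubC; congr ('X - _%:P); apply: real_rs.
Qed.

Lemma row_sqr_eq0 n (v : 'rV[R]_n) : ((v *m v^T) 0 0 == 0) = (v == 0).
Proof.
apply/eqP/eqP => [|->]; last by rewrite mul0mx mxE.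
rewrite mxE => /eqP; rewrite psumr_eq0 => [/allP v0|i _]; last first.
  by rewrite mxE -expr2 sqr_ge0.
apply/rowP => i; have := v0 i (mem_index_enum i).
by rewrite !mxE mulf_eq0 orbb => /eqP.
Qed.

(** Evaluating [v *m A *m w^T] from the left and, by symmetry, from the right gives [a] and [b]
    times the same product. *)
Lemma symmetric_eigen_orthogonal n (A : 'M[R]_n) (v w : 'rV[R]_n) a b :
  A^T = A -> v *m A = a *: v -> w *m A = b *: w -> a != b -> v *m w^T = 0.
Proof.
move=> symA Ev Ew; rewrite -subr_eq0 => nab.
have : a *: (v *m w^T) = b *: (v *m w^T).
  rewrite scalemxAl -Ev -mulmxA -[A in LHS]symA -trmx_mul Ew.
  by rewrite linearZ /= scalemxAr.
by move/eqP; rewrite -subr_eq0 -scalerBl scaler_eq0 (negPf nab) => /eqP.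
Qed.

(** The nonzero product with [e] already forces [v] to be nonzero, so [mu] is an eigenvalue. *)
Definition main_value n (A : 'M[R]_n) (e : 'rV[R]_n) (mu : R) :=
  exists2 v : 'rV[R]_n, v *m A = mu *: v & (v *m e^T) 0 0 != 0.

(** [w r] is the orthogonal projection of [e] on the eigenspace of [r], and [rs] keeps the [r] where
    it is nonzero. An eigenvector for [mu] is orthogonal to every [w r] with [r != mu], so it can
    meet [e] only through [w mu]; conversely [w mu] itself is a witness. *)
Lemma main_decomposition n (A : 'M[R]_n) (e : 'rV[R]_n) : A^T = A ->
  exists rs (w : R -> 'rV[R]_n),
    [/\ uniq rs, e = \sum_(r <- rs) w r,
        forall r, r \in rs -> w r *m A = r *: w r /\ w r != 0 &
        forall mu, main_value A e mu <-> mu \in rs].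
Proof.
move=> symA.
have /diagonalizablePeigen[rs0 urs0 full] := symmetric_diagonalizable symA.
have : (e <= \sum_(r <- rs0) eigenspace A r)%MS by rewrite full submx1.
rewrite (big_nth 0) big_mkord => /sub_sumsmxP[u eE].
(* As [rs0] has no repetition, the sum has at most one term; it turns a family indexed by positions
   into one indexed by eigenvalues. *)
pose w r := \sum_(i < size rs0 | rs0`_i == r) u i *m eigenspace A rs0`_i.
have wA r : w r *m A = r *: w r.
  apply/eigenspaceP; rewrite /w; apply: summx_sub => i /eqP <-.
  exact: submxMl.
have e0 : e = \sum_(r <- rs0) w r.
  rewrite eE /w (exchange_big_dep xpredT) //=; apply: eq_bigr => i _.
  rewrite big_mkcond (bigD1_seq rs0`_i) ?mem_nth //= eqxx big1 ?addr0 // => r.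
  by rewrite eq_sym => /negPf ->.
pose rs := [seq r <- rs0 | w r != 0].
have urs : uniq rs by rewrite filter_uniq.
have e1 : e = \sum_(r <- rs) w r.
  rewrite big_filter big_mkcond e0; apply: eq_bigr => r _.
  by case: eqP.
have eT (v : 'rV_n) : v *m e^T = \sum_(r <- rs) v *m (w r)^T.
  by rewrite e1 raddf_sum /= mulmx_sumr.
exists rs, w; split=> //.
  by move=> r; rewrite mem_filter => /andP[].
move=> mu; split=> [[v vA]|murs]; last first.
  exists (w mu) => //; rewrite eT (bigD1_seq mu) //= big1_seq.
    by rewrite addr0 row_sqr_eq0; move: murs; rewrite mem_filter => /andP[].
  move=> r /andP[nr _]; apply: (symmetric_eigen_orthogonal symA (wA mu) (wA r)).
  by rewrite eq_sym.
apply: contraR => nmu; rewrite eT big1_seq ?mxE // => r /andP[_ rrs].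
apply: (symmetric_eigen_orthogonal symA vA (wA r)).
by apply: contraNneq nmu => ->.
Qed.

(** On the orthogonal components [w r], the vectors [e], [e *m A] and [e *m A *m A] have coordinates
    1, [r] and [r * r]. A polynomial relation between them therefore says that the polynomial
    vanishes on [rs]: a monic quadratic bounds the size of [rs] by two, and the absence of a linear
    relation excludes size at most one. *)
Lemma two_main_valuesP n (A : 'M[R]_n) (e : 'rV[R]_n) : A^T = A ->
  (exists mu1 mu2, mu1 != mu2 /\
     forall mu, main_value A e mu <-> mu = mu1 \/ mu = mu2) <->
  (exists a b, e *m A *m A = a *: (e *m A) + b *: e) /\
  ~ exists c, e *m A = c *: e.
Proof.
move=> symA; have [rs [w [urs eE wE mainE]]] := main_decomposition e symA.
have eA : e *m A = \sum_(r <- rs) r *: w r.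
  by rewrite eE mulmx_suml; apply: eq_big_seq => r /wE[].
have eAA : e *m A *m A = \sum_(r <- rs) (r * r) *: w r.
  rewrite eA mulmx_suml; apply: eq_big_seq => r /wE[wA _].
  by rewrite -scalemxAl wA scalerA.
(* Multiplying by the transpose of [w r] isolates the coefficient of [w r]. *)
have pick (f : R -> R) r : \sum_(r <- rs) f r *: w r = 0 -> r \in rs -> f r = 0.
  move=> /(congr1 (mulmx^~ (w r)^T)) + rrs; have [rA nwr] := wE r rrs.
  rewrite mul0mx mulmx_suml (bigD1_seq r) //= big1_seq ?addr0.
    rewrite -scalemxAl => /matrixP/(_ 0 0); rewrite [LHS]mxE [RHS]mxE => /eqP.
    by rewrite mulf_eq0 row_sqr_eq0 (negPf nwr) orbF => /eqP.
  move=> s /andP[ns srs]; have [sA _] := wE s srs; rewrite -scalemxAl.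
  by rewrite (symmetric_eigen_orthogonal symA sA rA) ?scaler0.
split=> [[m1 [m2 [n12 mainm]]]|[[a [b ab]] noc]].
  have rsE r : r \in rs -> r = m1 \/ r = m2 by move/mainE/mainm.
  split.
    (* The coefficients come from the quadratic with roots [m1] and [m2]. *)
    exists (m1 + m2), (- (m1 * m2)); rewrite eAA eA eE !scaler_sumr -big_split /=.
    apply: eq_big_seq => r /rsE rm; rewrite !scalerA -scalerDl.
    by congr (_ *: _); case: rm => ->; ring.
  case=> c /eqP; rewrite eA eE scaler_sumr -subr_eq0 -sumrB => /eqP ec.
  have cE r : r \in rs -> r = c.
    move=> rrs; apply/eqP; rewrite -subr_eq0; apply/eqP.
    by apply: (pick (fun r => r - c)) rrs; rewrite -[RHS]ec;
      apply: eq_bigr => s _; rewrite scalerBl.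
  have m1c : m1 = c by apply: cE; apply/mainE/mainm; left.
  have m2c : m2 = c by apply: cE; apply/mainE/mainm; right.
  by case/eqP: n12; rewrite m1c m2c.
have quad r : r \in rs -> r * r - a * r - b = 0.
  apply: (pick (fun r => r * r - a * r - b)).
  move/eqP: ab; rewrite -subr_eq0 eAA eA eE !scaler_sumr -big_split -sumrB /=.
  move=> /eqP ab0; rewrite -[RHS]ab0; apply: eq_bigr => s _.
  by rewrite !scalerA -scalerDl -scalerBl; congr (_ *: _); ring.
have [s1 s1rs] : exists s1, s1 \in rs.
  (* If [rs] were empty, [e] would be zero and [noc] would fail with [c = 0]. *)
  case: (rs) eE => [|r rs' _]; last by exists r; rewrite mem_head.
  by rewrite big_nil => e0; case: noc; exists 0; rewrite e0 mul0mx scaler0.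
have [s2 s2rs s21] : exists2 s2, s2 \in rs & s2 != s1.
  apply/hasP; rewrite -[has _ _]negbK -all_predC; apply/negP => /allP all1.
  case: noc; exists s1; rewrite eA eE scaler_sumr; apply: eq_big_seq => r rrs.
  by have /= := all1 r rrs; rewrite negbK => /eqP ->.
exists s2, s1; split=> // mu; rewrite mainE; split=> [murs|[]->] //.
have q1 := quad _ s1rs; have q2 := quad _ s2rs; have q := quad _ murs.
(* Three roots of one monic quadratic cannot be distinct: their Vandermonde product is a combination
   of the three values of the quadratic in which [a] and [b] cancel. *)
have /eqP : (s2 - s1) * ((mu - s2) * (mu - s1)) = 0.
  rewrite -[RHS](_ : (s2 - s1) * (mu * mu - a * mu - b)
    - (mu - s1) * (s2 * s2 - a * s2 - b) + (mu - s2) * (s1 * s1 - a * s1 - b) = 0).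
    ring.
  by rewrite q1 q2 q !mulr0 subr0 addr0.
rewrite !mulf_eq0 !subr_eq0 (negPf s21) /= => /orP[]/eqP; by [left|right].
Qed.

End SymmetricMatrix.

(** * Main signless Laplacian eigenvalues and degrees *)

Definition nbr_deg_sum (G : sgraph) (x : G) : nat :=
  \sum_(y : G | sedge x y) deg y.

Definition degree_determined (G : sgraph) : Prop :=
  forall x y : G, deg x = deg y -> nbr_deg_sum x = nbr_deg_sum y.

Section SignlessLaplacian.
Local Open Scope ring_scope.
Variables (R : realType) (G : sgraph).

Lemma signless_laplacian_sym :
  (signless_laplacian R G)^T = signless_laplacian R G.
Proof.
rewrite /signless_laplacian linearD /= tr_diag_mx; congr (_ + _).
by apply/matrixP => i j; rewrite !mxE sedge_sym.
Qed.

Lemma mul_signless_laplacian (f : G -> R) j :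
  ((\row_i f (enum_val i)) *m signless_laplacian R G) 0 j =
  (deg (enum_val j : G))%:R * f (enum_val j) +
  \sum_(y : G | sedge (enum_val j) y) f y.
Proof.
rewrite mulmxDr mxE mul_mx_diag !mxE mulrC; congr (_ + _).
rewrite [RHS]big_mkcond /= (reindex (enum_val (A := G))) /=; last first.
  exact/onW_bij/enum_val_bij.
apply: eq_bigr => i _; rewrite !mxE sedge_sym.
by case: sedge; rewrite ?mulr1 ?mulr0.
Qed.

Lemma sum1_nbr (x : G) : \sum_(y : G | sedge x y) 1 = (deg x)%:R :> R.
Proof.
rewrite sumr_const /deg; congr (_%:R); apply: eq_card => y.
by rewrite !inE.
Qed.

(** The diagonal and the adjacency part each contribute the degree to a row sum, so [e *m Q] is
    twice the degree vector. Halving the quadratic relation keeps [a] and turns [b] into [b / 2]. *)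
Lemma two_main_signless_eigenvaluesP :
  exactly_two_main_signless_eigenvalues R G <->
  (exists a b : R, forall x : G,
     (deg x)%:R ^+ 2 + (nbr_deg_sum x)%:R = a * (deg x)%:R + b) /\
  ~ exists c : R, forall x : G, (deg x)%:R = c.
Proof.
pose e : 'rV[R]_#|G| := \row_i 1; set Q := signless_laplacian R G.
have eQ : e *m Q = \row_i (2 * (deg (enum_val i : G))%:R).
  apply/rowP => j; rewrite (mul_signless_laplacian (fun=> 1)) mxE mulr1.
  by rewrite sum1_nbr mulrDl mul1r.
have eQQ : e *m Q *m Q = \row_i (2 * ((deg (enum_val i : G))%:R ^+ 2 +
                                   (nbr_deg_sum (enum_val i : G))%:R)).
  apply/rowP => j; rewrite eQ (mul_signless_laplacian (fun x => 2 * (deg x)%:R)).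
  by rewrite mxE -mulr_sumr /nbr_deg_sum natr_sum; ring.
have mainE mu : main_signless_eigenvalue G mu <-> main_value Q e mu.
  have dotE (v : 'rV[R]_#|G|) : (v *m e^T) 0 0 = \sum_i v 0 i.
    by rewrite mxE; apply: eq_bigr => i _; rewrite !mxE mulr1.
  split=> [[_ [v /eigenspaceP vQ nv]]|[v vQ nv]].
    by exists v; rewrite ?dotE.
  rewrite dotE in nv; split; last by exists v => //; apply/eigenspaceP.
  apply/eigenvalueP; exists v => //; apply: contraNneq nv => ->.
  by rewrite big1 // => i _; rewrite mxE.
have two0 : 2 != 0 :> R by rewrite pnatr_eq0.
have -> : exactly_two_main_signless_eigenvalues R G <->
  exists mu1 mu2, mu1 != mu2 /\
     forall mu, main_value Q e mu <-> mu = mu1 \/ mu = mu2.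
  by split=> -[m1 [m2 [n12 mE]]]; exists m1, m2; split=> // mu;
    rewrite -mE mainE.
rewrite (two_main_valuesP e signless_laplacian_sym) -/Q eQQ eQ.
split=> -[[a [b ab]] noc]; split.
- exists a, (b / 2) => x; move/rowP/(_ (enum_rank x)): ab.
  rewrite !mxE enum_rankK mulr1 => abx; apply: (mulfI two0); rewrite abx.
  by field.
- case=> c cE; apply: noc; exists (2 * c); apply/rowP => i.
  by rewrite !mxE cE mulr1.
- exists a, (2 * b); apply/rowP => i; rewrite !mxE ab; ring.
- case=> c /rowP cE; apply: noc; exists (c / 2) => x.
  have := cE (enum_rank x); rewrite !mxE enum_rankK mulr1 => <-.
  by field.
Qed.

End SignlessLaplacian.

(** * Degree sum and possible degree sequences *)

Section Degrees.
Variable G : sgraph.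
Implicit Types x y p q w : G.

(** Incidences are counted twice over: [y] mapped to [[set x; y]] matches the neighbours of [x] with
    the edges containing [x], and an edge has two elements because there are no loops. *)
Lemma sum_deg : \sum_(x : G) deg x = #|edges G|.*2.
Proof.
have degE x : deg x = \sum_(E in edges G) if x \in E then 1 else 0.
  rewrite -big_mkcondr /= sum1dep_card /deg.
  have inj : {in [set y | sedge x y] &, injective (fun y => [set x; y])}.
    move=> y z; rewrite !inE => xy _ eqE.
    have : y \in [set x; z] by rewrite -eqE set22.
    rewrite !inE => /orP[/eqP yx|/eqP //].
    by rewrite yx sedge_irrefl in xy.
  rewrite -(card_in_imset inj); apply: eq_card => E; rewrite !inE.
  apply/imsetP/andP => [[y]|[/imset2P[y z _]]].
    rewrite inE => xy ->; rewrite set21; split=> //.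
    by apply/imset2P; exists x y; rewrite ?inE.
  rewrite inE => yz -> ; rewrite !inE => /orP[]/eqP ->.
    by exists z; rewrite ?inE.
  by exists y; rewrite ?inE 1?sedge_sym // setUC.
under eq_bigr do rewrite degE.
rewrite exchange_big /= -muln2 -sum_nat_const; apply: eq_bigr => E.
case/imset2P => y z _; rewrite inE => /andP[_ yz] ->.
rewrite -big_mkcond /= sum1_card cards2; case: eqP => // yz0.
by rewrite yz0 sedge_irrefl in yz.
Qed.

Lemma min_degree_le x : min_degree G <= deg x.
Proof.
rewrite /min_degree; have := mem_index_enum x.
elim: (index_enum G) => // y s IHs; rewrite in_cons big_cons geq_min.
by case/orP=> [/eqP <-|/IHs ->]; rewrite ?leqnn ?orbT.
Qed.

Variant degree_profile : Prop :=
  | OneDegree4 w of deg w = 4 & (forall x, x != w -> deg x = 2)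
  | TwoDegree3 p q of p != q & deg p = 3 & deg q = 3 &
      (forall x, x != p -> x != q -> deg x = 2).

Lemma degree_profileP : #|edges G| = #|G|.+1 -> 1 < min_degree G ->
  degree_profile.
Proof.
move=> cardE degG; have deg2 x : 1 < deg x by apply: leq_trans (min_degree_le x).
(* The truncated subtraction is exact since every degree is at least 2. *)
have sumE : \sum_(x : G) (deg x - 2) = 2.
  have : \sum_(x : G) (deg x - 2) + \sum_(x : G) 2 = #|G|.+1.*2.
    rewrite -big_split /= -cardE -sum_deg; apply: eq_bigr => x _.
    by rewrite subnK.
  have -> : \sum_(x : G) 2 = #|G| * 2 by rewrite sum_nat_const.
  by lia.
have [p p3] : exists p, 0 < deg p - 2.
  apply/existsP; apply: contraTT isT; rewrite negb_exists => /forallP no.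
  by move: sumE; rewrite big1 // => x _; have := no x; lia.
have := sumE; rewrite (bigD1 p) //=.
have [p4|p4 sum1] := leqP 4 (deg p).
  move=> sum0; have : \sum_(x | x != p) (deg x - 2) = 0 by lia.
  move/eqP; rewrite sum_nat_eq0 => /forallP d0; apply: (OneDegree4 (w := p)).
    by lia.
  by move=> x xp; have := d0 x; rewrite xp /=; have := deg2 x; lia.
have {}sum1 : \sum_(x | x != p) (deg x - 2) = 1 by lia.
have [q /andP[qp q3]] : exists q, (q != p) && (0 < deg q - 2).
  apply/existsP; apply: contraTT isT; rewrite negb_exists => /forallP no.
  by move: sum1; rewrite big1 // => x xp; have := no x; rewrite xp /=; lia.
move: sum1; rewrite (bigD1 q) //= => sum1.
have /eqP : \sum_(x | (x != p) && (x != q)) (deg x - 2) = 0 by lia.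
rewrite sum_nat_eq0 => /forallP d0; apply: (TwoDegree3 (p := p) (q := q)).
- by rewrite eq_sym.
- by lia.
- by lia.
- by move=> x xp xq; have := d0 x; rewrite xp xq /=; have := deg2 x; lia.
Qed.

End Degrees.

(** * Graphs with exactly two distinct degrees *)

Section TwoDegrees.
Variable G : sgraph.
Implicit Types x y z p q w : G.

Lemma deg_sum1 x : deg x = \sum_(y | sedge x y) 1.
Proof. by rewrite /deg sum1dep_card. Qed.

(** Written as a sum with a boolean, so that one equation serves whether or not [x] and [y] are
    adjacent. *)
Lemma card_nbrD1 x y : #|[set z | sedge x z] :\ y| + sedge x y = deg x.
Proof. by rewrite /deg [RHS](cardsD1 y) inE addnC. Qed.

Lemma sum_nbr_eq x p : \sum_(y | sedge x y) (y == p) = sedge x p.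
Proof.
rewrite big_mkcond (bigD1 p) //= eqxx big1 ?addn0 => [|y /negPf ->].
  by case: sedge.
by case: ifP.
Qed.

(** Supplies the two interpolation points below; the vertex of degree 2 is found next to a vertex of
    larger degree. *)
Lemma degree_profile_two_values : degree_profile G ->
  exists l x y, [/\ 2 < l, deg x = 2, deg y = l &
                 forall z, deg z = 2 \/ deg z = l].
Proof.
case=> [w w4 d2|p q pq p3 q3 d2].
  have /card_gt0P[x] : 0 < #|[set x | sedge w x]| by rewrite -/(deg w) w4.
  rewrite inE => wx; exists 4, x, w; split=> //.
    by apply: d2; apply: contraTneq wx => ->; rewrite sedge_irrefl.
  by move=> z; have [->|/d2] := eqVneq z w; [right|left].
have /card_gt0P[x] : 0 < #|[set x | sedge p x] :\ q|.
  by have := card_nbrD1 p q; rewrite p3; case: sedge; lia.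
rewrite !inE => /andP[xq px]; exists 3, x, p; split=> //.
  by apply: d2 => //; apply: contraTneq px => ->; rewrite sedge_irrefl.
move=> z; have [->|zp] := eqVneq z p; first by right.
by have [->|zq] := eqVneq z q; [right|left; apply: d2].
Qed.

(** Any function on a set of two degrees is affine, so being affine in the degree only means being
    determined by it. *)
Lemma two_main_degree_determined (R : realType) : degree_profile G ->
  exactly_two_main_signless_eigenvalues R G <-> degree_determined G.
Proof.
move=> /degree_profile_two_values[l [x2 [xl [l2 dx2 dxl dG]]]].
rewrite two_main_signless_eigenvaluesP; split=> [[[a [b ab]] _] x y dxy|dd].
  apply/eqP; rewrite -(eqr_nat R); apply/eqP; apply: (addrI ((deg x)%:R ^+ 2)%R).
  by rewrite ab dxy ab.
have nl : (l%:R - 2%:R != 0 :> R)%R by rewrite subr_eq0 eqr_nat; lia.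
split.
  (* Slope of the line through the values at degrees 2 and [l]. *)
  pose t := (((l%:R ^+ 2 + (nbr_deg_sum xl)%:R) - (4 + (nbr_deg_sum x2)%:R))
              / (l%:R - 2%:R))%R : R.
  exists t, (4 + (nbr_deg_sum x2)%:R - t * 2)%R => x.
  case: (dG x) => dx; rewrite dx.
    by rewrite (dd x x2) ?dx ?dx2 //; ring.
  by rewrite (dd x xl) ?dx ?dxl // /t; field.
by case=> c cE; case/negP: nl; rewrite -dxl -dx2 !cE subrr.
Qed.

End TwoDegrees.

(** * Isomorphisms with graphs given by edge lists *)

Lemma iso_deg (G H : sgraph) (f : G -> H) : bijective f ->
  (forall x y, sedge (f x) (f y) = sedge x y) -> forall x, deg (f x) = deg x.
Proof.
move=> bijf fE x; rewrite !deg_sum1 (reindex f) /=; last exact: onW_bij.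
by apply: eq_bigl => y; rewrite fE.
Qed.

Lemma iso_degree_determined (G H : sgraph) :
  iso G H -> degree_determined H -> degree_determined G.
Proof.
case=> f [bijf fE] ddH x y; have degf := iso_deg bijf fE.
have sumf z : nbr_deg_sum (f z) = nbr_deg_sum z.
  rewrite /nbr_deg_sum (reindex f) /=; last exact: onW_bij.
  by apply: eq_big => [u|u _]; rewrite ?fE ?degf.
by rewrite -(degf x) -(degf y) => /ddH; rewrite !sumf.
Qed.

(** Thanks to this, a relabelled vertex list only needs its covering property checked again. *)
Lemma uniq_cover (G : sgraph) (l : seq G) : (forall x, x \in l) -> #|G| = size l -> uniq l.
Proof.
move=> cover cardG; apply: (leq_size_uniq (enum_uniq G)) => [x _|].
  exact: cover.
by rewrite -cardG cardE.
Qed.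

Section EdgeLists.
Variables (n : nat) (s : seq (nat * nat)).

(** This and the next definitions are counterparts over [nat] of adjacency, degree and neighbour
    sum, which evaluate by computation on a concrete edge list. *)
Definition list_rel (i j : nat) : bool :=
  (i != j) && (((i, j) \in s) || ((j, i) \in s)).

Definition list_deg (i : nat) : nat :=
  sumn [seq nat_of_bool (list_rel i j) | j <- iota 0 n].

Definition list_nbr_deg_sum (i : nat) : nat :=
  sumn [seq list_rel i j * list_deg j | j <- iota 0 n].

Lemma sumn_iota (F : nat -> nat) :
  sumn [seq F j | j <- iota 0 n] = \sum_(j < n) F j.
Proof. by rewrite sumnE big_map -{1}(subn0 n) big_mkord. Qed.

Lemma list_degE (i : edge_list_graph n s) : deg i = list_deg i.
Proof.
rewrite deg_sum1 /list_deg sumn_iota big_mkcond /=; apply: eq_bigr => j _.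
by rewrite /list_rel /edge_list_rel -val_eqE; case: ifP.
Qed.

Lemma list_nbr_deg_sumE (i : edge_list_graph n s) :
  nbr_deg_sum i = list_nbr_deg_sum i.
Proof.
rewrite /nbr_deg_sum /list_nbr_deg_sum sumn_iota big_mkcond /=.
apply: eq_bigr => j _; rewrite list_degE.
by rewrite /list_rel /edge_list_rel -val_eqE; case: ifP; rewrite ?mul1n.
Qed.

Definition list_degree_determined : bool :=
  all (fun i => all (fun j => (list_deg i == list_deg j) ==>
    (list_nbr_deg_sum i == list_nbr_deg_sum j)) (iota 0 n)) (iota 0 n).

Lemma edge_list_degree_determined :
  list_degree_determined -> degree_determined (edge_list_graph n s).
Proof.
move=> /allP dd x y; rewrite !list_degE !list_nbr_deg_sumE => /eqP dxy.
have inI (z : 'I_n) : (z : nat) \in iota 0 n by rewrite mem_iota ltn_ord.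
have /allP/(_ y (inI y)) := dd x (inI x).
by rewrite dxy => /eqP.
Qed.

(* A vertex enumeration carrying the edges of the list to edges of [G] is an
   isomorphism because both graphs have the same number of edges. *)
Lemma iso_edge_list (G : sgraph) (x0 : G) (l : seq G) :
  #|edges G| = #|G|.+1 -> #|G| = n -> size l = n -> (forall x, x \in l) ->
  all (fun e => sedge (nth x0 l e.1) (nth x0 l e.2)) s ->
  sumn [seq list_deg i | i <- iota 0 n] = n.+1.*2 ->
  iso G (edge_list_graph n s).
Proof.
move=> edgesG cardG sizel inl /allP sG sumH.
have ul : uniq l by apply: uniq_cover; rewrite ?sizel.
have ltx x : index x l < n by rewrite -sizel index_mem.
pose f x : edge_list_graph n s := Ordinal (ltx x).
pose g (i : edge_list_graph n s) := nth x0 l i.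
have fg : cancel f g by move=> x; rewrite /g /f /= nth_index.
have gf : cancel g f by move=> i; apply: val_inj; rewrite /= index_uniq ?sizel.
have bijg : bijective g by exists f.
have gE i j : sedge i j -> sedge (g i) (g j).
  by case/andP=> _ /orP[/sG|/sG] //=; rewrite sedge_sym.
(* Ordered adjacent pairs, counted by the degree sum on either side: both sets have [n.+1.*2]
   elements, so the inclusion given by [gE] is an equality. *)
pose SH := [set e : 'I_n * 'I_n | sedge (e.1 : edge_list_graph n s) e.2].
pose SG := [set e : 'I_n * 'I_n | sedge (g e.1) (g e.2)].
have card_pairs (r : rel 'I_n) : #|[set e : 'I_n * 'I_n | r e.1 e.2]| =
    \sum_i \sum_(j | r i j) 1.
  rewrite pair_big_dep /= sum1dep_card; apply: eq_card => e.
  by rewrite !inE.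
have eqS : SH = SG.
  apply/eqP; rewrite eqEcard; apply/andP; split.
    by apply/subsetP => e; rewrite !inE => /gE.
  have -> : #|SG| = n.+1.*2.
    rewrite -[in RHS]cardG -edgesG -sum_deg (reindex g) /=; last exact: onW_bij.
    rewrite /SG (card_pairs (fun i j => sedge (g i) (g j))).
    apply: eq_bigr => i _; rewrite deg_sum1 [RHS](reindex g) //=.
    exact: onW_bij.
  rewrite -sumH sumn_iota /SH.
  rewrite (card_pairs (fun i j => sedge (i : edge_list_graph n s) j)).
  apply: leq_sum => i _.
  by rewrite -(list_degE (i : edge_list_graph n s)) deg_sum1.
exists f; split=> [|x y]; first by exists g.
by have /setP/(_ (f x, f y)) := eqS; rewrite !inE /= !fg => ->.
Qed.

End EdgeLists.

(** * Classification *)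

(** For a vertex list that is a permutation of the one covered by [H]. *)
Ltac cover_from H :=
  let z := fresh "z" in
  move=> z; have := H z; rewrite !inE; do ?[case/orP]; move=> ->; rewrite ?orbT.

Ltac check_edges :=
  rewrite /= ?andbT; do ?[apply/andP; split]; by [|rewrite sedge_sym].

(** Substituting the equality [E] of two listed vertices creates a repetition in the duplicate-free
    list of [U]. *)
Ltac clash E U :=
  move: U; rewrite E /= !inE !eqxx ?orbT /= ?andbF.

Ltac neq_from U :=
  let E := fresh "E" in apply/eqP => E; clash E U.

Section Classification.
Variable G : sgraph.
Hypothesis edgesG : #|edges G| = #|G|.+1.
Hypothesis ddG : degree_determined G.
Implicit Types x y z p q w : G.

Lemma sedge_neq x y : sedge x y -> x != y.
Proof. by apply: contraTneq => ->; rewrite sedge_irrefl. Qed.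

Lemma deg2_other x y : deg x = 2 -> exists2 z, sedge x z & z != y.
Proof.
move=> x2; have /card_gt0P[z] : 0 < #|[set z | sedge x z] :\ y|.
  by have := card_nbrD1 x y; rewrite x2; case: sedge; lia.
by rewrite !inE => /andP[]; exists z.
Qed.

Lemma deg2_nbr x y z u : deg x = 2 -> sedge x y -> sedge x z -> y != z ->
  sedge x u -> u = y \/ u = z.
Proof.
move=> x2 xy xz yz xu; have /eqP/setP/(_ u) : [set y; z] == [set u | sedge x u].
  rewrite eqEcard cards2 yz -/(deg x) x2 andbT.
  by apply/subsetP => v; rewrite !inE => /orP[]/eqP->.
by rewrite !inE xu => /orP[]/eqP ->; [left|right].
Qed.

Lemma card_cover (l : seq G) : uniq l -> (forall x, x \in l) -> #|G| = size l.
Proof.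
move=> ul cover; rewrite -(card_uniqP ul); apply: eq_card => x.
by rewrite cover.
Qed.

(** Once all vertices are adjacent to [w], each other vertex has exactly one neighbour besides [w].
    This pairs the four neighbours of [w] and yields two triangles through [w]. *)
Lemma classify_degree4 w : deg w = 4 -> (forall x, x != w -> deg x = 2) ->
  iso G bowtie.
Proof.
move=> w4 d2.
have degE x : deg x = 2 + (x == w) * 2.
  by have [->|/d2 ->] := eqVneq x w; rewrite ?w4.
have sumE x : x != w -> nbr_deg_sum x = 4 + sedge x w * 2.
  move=> xw; rewrite /nbr_deg_sum; under eq_bigr do rewrite degE.
  by rewrite big_split /= -big_distrl /= sum_nbr_eq -[2]mul1n -big_distrl /=
             -deg_sum1 d2.
have [a] : exists a, a \in [set x | sedge w x].
  by apply/card_gt0P; rewrite -/(deg w) w4.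
rewrite inE => wa; have aw := sedge_neq wa; rewrite eq_sym in aw.
have adjw x : x != w -> sedge w x.
  move=> xw; have := ddG (etrans (d2 x xw) (esym (d2 a aw))).
  by rewrite !sumE // ![sedge _ w]sedge_sym wa; case: sedge.
have [b ab bw] := deg2_other w (d2 a aw); have wb := adjw b bw.
have : #|[set x | sedge w x] :\ a :\ b| = 2.
  have := card_nbrD1 w a; rewrite (cardsD1 b) !inE wa wb w4.
  by rewrite (eq_sym b a) (sedge_neq ab) /=; lia.
move=> /eqP/cards2P[c [d [cd /setP setE]]].
have := setE c; have := setE d; rewrite !inE !eqxx ?orbT.
move=> /and3P[db da wd] /and3P[cb ca wc].
have cover x : x \in [:: w; a; b; c; d].
  have := setE x; rewrite !inE.
  have [//|xw] := eqVneq x w; rewrite (adjw x xw) andbT /=.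
  by case: (x == b); case: (x == a); case: (x == c); case: (x == d).
have cw : c != w by rewrite eq_sym sedge_neq.
have [e ce ew] := deg2_other w (d2 c cw).
(* The neighbour [e] of [c] is neither [a] nor [b], whose two neighbours are already [w] and each
   other. *)
have ed : e = d.
  have := cover e; rewrite !inE (negPf ew) /= => /or4P[]/eqP E //; subst e.
  - move: wa ce; rewrite sedge_sym [sedge c a]sedge_sym => wa ce.
    have [/eqP|/eqP] := deg2_nbr (d2 a aw) wa ab (sedge_neq wb) ce.
      by rewrite (negPf cw).
    by rewrite (negPf cb).
  - move: wb ab ce; rewrite sedge_sym [sedge a b]sedge_sym [sedge c b]sedge_sym.
    move=> bw' ba bc.
    have [/eqP|/eqP] := deg2_nbr (d2 b bw) bw' ba (sedge_neq wa) bc.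
      by rewrite (negPf cw).
    by rewrite (negPf ca).
  - by rewrite sedge_irrefl in ce.
subst e; apply: (iso_edge_list (x0 := w) (l := [:: w; a; b; c; d])) => //.
  rewrite (card_cover _ cover) //= !inE !negb_or ![w == _]eq_sym.
  rewrite aw bw cw ew (sedge_neq ab) ![a == _]eq_sym ca da.
  by rewrite ![b == _]eq_sym cb db cd.
by check_edges.
Qed.

(** * Two vertices of degree 3 *)

Section TwoDegree3.
Variables p q : G.
Hypotheses (pq : p != q) (p3 : deg p = 3) (q3 : deg q = 3).
Hypothesis d2 : forall x, x != p -> x != q -> deg x = 2.

Lemma nbr_deg_sum_degree2 x : x != p -> x != q ->
  nbr_deg_sum x = 4 + (sedge p x + sedge q x).
Proof.
move=> xp xq; have degE y : deg y = 2 + ((y == p) + (y == q)).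
  have [->|yp] := eqVneq y p; first by rewrite p3 (negPf pq).
  by have [->|yq] := eqVneq y q; rewrite ?q3 ?d2.
rewrite /nbr_deg_sum; under eq_bigr do rewrite degE.
rewrite big_split big_split /= !sum_nbr_eq -[2]mul1n -big_distrl /=.
by rewrite -deg_sum1 d2 // ![sedge x _]sedge_sym.
Qed.

Lemma card_nbr_p : #|[set x | sedge p x] :\ q| = 3 - sedge p q.
Proof. by rewrite -p3 -(card_nbrD1 p q) addnK. Qed.

Lemma card_nbr_q : #|[set x | sedge q x] :\ p| = 3 - sedge p q.
Proof. by rewrite -q3 -(card_nbrD1 q p) sedge_sym addnK. Qed.

(** The vertices of degree 2 are the midpoints of paths of length 2 from [p] to [q]; there are two
    of them if [p] and [q] are adjacent, three otherwise. *)
Lemma classify_both :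
  (forall x, x != p -> x != q -> sedge p x && sedge q x) ->
  iso G (theta 2 2 1) \/ iso G (theta 2 2 2).
Proof.
move=> both; pose s := enum ([set x | sedge p x] :\ q).
have sP x : (x \in s) = (x != p) && (x != q).
  rewrite mem_enum !inE andbC; have [->|xp] := eqVneq x p.
    by rewrite sedge_irrefl.
  have [//|xq] := eqVneq x q; first by rewrite andbF.
  by have /andP[->] := both x xp xq.
have us : uniq (p :: q :: s).
  by rewrite /= inE !sP !eqxx (negPf pq) andbF enum_uniq.
have cover x : x \in p :: q :: s.
  by rewrite !inE sP; case: (x == p); case: (x == q).
have sE x : x \in s -> sedge p x && sedge q x.
  by rewrite sP => /andP[]; apply: both.
have sizes : size s = 3 - sedge p q by rewrite -cardE card_nbr_p.
have cardG := card_cover us cover.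
case: (boolP (sedge p q)) sizes => epq /=.
  case: s cover sE cardG {us sP} => [|a [|b []]] // cover sE cardG _; left.
  have /andP[pa qa] := sE a (mem_head _ _).
  have /andP[pb qb] : sedge p b && sedge q b by apply: sE; rewrite !inE eqxx orbT.
  apply: (iso_edge_list (x0 := p) (l := [:: p; q; a; b])) => //.
  by check_edges.
case: s cover sE cardG {us sP} => [|a [|b [|c []]]] // cover sE cardG _; right.
have /andP[pa qa] := sE a (mem_head _ _).
have /andP[pb qb] : sedge p b && sedge q b by apply: sE; rewrite !inE eqxx orbT.
have /andP[pc qc] : sedge p c && sedge q c by apply: sE; rewrite !inE eqxx !orbT.
apply: (iso_edge_list (x0 := p) (l := [:: p; q; a; b; c])) => //.
by check_edges.
Qed.

Section ExactlyOne.
Hypothesis one : forall x, x != p -> x != q -> sedge p x = ~~ sedge q x.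

(* Each degree-2 vertex has exactly one neighbour of degree 2, so adjacency
   restricts to a perfect matching of the degree-2 vertices. *)
Lemma mate : exists m : G -> G, forall x, x != p -> x != q ->
  [/\ m x != p, m x != q, m x != x, sedge x (m x) & m (m x) = x].
Proof.
have uniq_mate x y z : x != p -> x != q -> y != p -> y != q -> z != p -> z != q ->
    sedge x y -> sedge x z -> y = z.
  move=> xp xq yp yq zp zq xy xz.
  (* [r] is the one of [p] and [q] adjacent to [x]; it takes one of the two places next to [x]. *)
  have [r [xr yr zr]] : exists r, [/\ sedge x r, r != y & z != r].
    have := one xp xq; have [qx _|_ px] := boolP (sedge q x).
      by exists q; rewrite sedge_sym (eq_sym q).
    by exists p; rewrite sedge_sym px (eq_sym p).
  have [/eqP|//] := deg2_nbr (d2 xp xq) xr xy yr xz.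
  by rewrite (negPf zr).
have ex x : x != p -> x != q ->
    exists2 y, sedge x y & (y != p) && (y != q).
  move=> xp xq; have := one xp xq; have [qx npx|nqx px] := boolP (sedge q x).
    have [y xy yq] := deg2_other q (d2 xp xq); exists y => //; rewrite yq andbT.
    by apply: contraFneq npx => <-; rewrite sedge_sym.
  have [y xy yp] := deg2_other p (d2 xp xq); exists y => //; rewrite yp.
  by apply: contraNneq nqx => <-; rewrite sedge_sym.
(* The default value can occur only at [p] or [q], by [ex]. *)
pose m x := odflt x [pick y | sedge x y && ((y != p) && (y != q))].
have mP x : x != p -> x != q -> [/\ sedge x (m x), m x != p & m x != q].
  move=> xp xq; rewrite /m; case: pickP => [y /and3P[]//|no].
  by have [y xy yT] := ex x xp xq; have := no y; rewrite /= xy yT.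
exists m => x xp xq; have [xm mp mq] := mP x xp xq; split=> //.
  by rewrite eq_sym sedge_neq.
have [mmx mmp mmq] := mP _ mp mq.
by apply: (uniq_mate (m x)) => //; rewrite sedge_sym.
Qed.

(** By [one], the vertices other than [p] and [q] split into neighbours of [p] and neighbours of
    [q], so there are 6 or 8 vertices in all. *)
Lemma nbr_lists : exists sp sq : seq G,
  [/\ size sp = 3 - sedge p q, size sq = 3 - sedge p q,
      all (sedge p) sp, all (sedge q) sq &
      uniq (p :: q :: sp ++ sq) /\ forall x, x \in p :: q :: sp ++ sq].
Proof.
pose sp := enum ([set x | sedge p x] :\ q).
pose sq := enum ([set x | sedge q x] :\ p).
have spE x : (x \in sp) = (x != q) && sedge p x by rewrite mem_enum !inE.
have sqE x : (x \in sq) = (x != p) && sedge q x by rewrite mem_enum !inE.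
exists sp, sq; split.
- by rewrite -cardE card_nbr_p.
- by rewrite -cardE card_nbr_q.
- by apply/allP => x; rewrite spE => /andP[].
- by apply/allP => x; rewrite sqE => /andP[].
split=> [|x].
  rewrite /= cat_uniq !enum_uniq !inE !mem_cat !spE !sqE !eqxx !sedge_irrefl.
  rewrite (negPf pq) !andbF !andbT /=; apply/hasPn => x /=.
  rewrite sqE spE => /andP[xp qx]; rewrite (one xp) ?qx ?andbF //.
  by rewrite eq_sym sedge_neq.
rewrite !inE mem_cat spE sqE; have [//|xp] := eqVneq x p.
by have [//|xq] := eqVneq x q; rewrite /= one // orNb.
Qed.

(** * Perfect matchings of the vertices of degree 2 *)

Section Mate.
Variable m : G -> G.
Hypothesis mP : forall x, x != p -> x != q ->
  [/\ m x != p, m x != q, m x != x, sedge x (m x) & m (m x) = x].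

(** If [a] is matched with [b], then [c] is matched with [d], which gives two triangles joined by
    the edge [pq]. Otherwise both pairs cross and form two paths of length 3 parallel to that
    edge. *)
Lemma classify_adjacent a b c d :
  sedge p q -> all (sedge p) [:: a; b] -> all (sedge q) [:: c; d] ->
  (forall x, x \in [:: p; q; a; b; c; d]) -> uniq [:: p; q; a; b; c; d] ->
  iso G (dumbbell 1) \/ iso G (theta 3 3 1).
Proof.
move=> epq /and3P[pa pb _] /and3P[qc qd _] cover U.
have cardG := card_cover U cover.
have [|| map maq maa ama mma] := @mP a; try by neq_from U.
have [|| mbp mbq mbb bmb mmb] := @mP b; try by neq_from U.
have [|| mcp mcq mcc cmc mmc] := @mP c; try by neq_from U.
have := cover (m a); rewrite !inE (negPf map) (negPf maq) (negPf maa) /=.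
case/or3P=> /eqP Ea; rewrite Ea in ama mma.
- left; have := cover (m c).
  rewrite !inE (negPf mcp) (negPf mcq) (negPf mcc) /= => /or3P[]/eqP Ec.
  + by rewrite Ec Ea in mmc; clash mmc U.
  + by rewrite Ec mma in mmc; clash mmc U.
  rewrite Ec in cmc.
  apply: (iso_edge_list (x0 := p) (l := [:: p; a; b; q; c; d])) => //.
    by cover_from cover.
  by check_edges.
- right; have := cover (m b).
  rewrite !inE (negPf mbp) (negPf mbq) (negPf mbb) /= => /or3P[]/eqP Eb.
  + by rewrite Eb Ea in mmb; clash mmb U.
  + by rewrite Eb mma in mmb; clash mmb U.
  rewrite Eb in bmb.
  apply: (iso_edge_list (x0 := p) (l := [:: p; q; a; c; b; d])) => //.
    by cover_from cover.
  by check_edges.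
- right; have := cover (m b).
  rewrite !inE (negPf mbp) (negPf mbq) (negPf mbb) /= => /or3P[]/eqP Eb.
  + by rewrite Eb Ea in mmb; clash mmb U.
  + rewrite Eb in bmb.
    apply: (iso_edge_list (x0 := p) (l := [:: p; q; a; d; b; c])) => //.
      by cover_from cover.
    by check_edges.
  by rewrite Eb mma in mmb; clash mmb U.
Qed.

(** The remaining [e] and [f] must be matched: the triangles are [p a b] and [q e f], joined by the
    path [p c d q]. *)
Lemma iso_dumbbell3 a b c d e f :
  all (sedge p) [:: a; b; c] -> all (sedge q) [:: d; e; f] ->
  (forall x, x \in [:: p; q; a; b; c; d; e; f]) -> #|G| = 8 ->
  m a = b -> m c = d -> iso G (dumbbell 3).
Proof.
move=> /and4P[pa pb pc _] /and4P[qd qe qf _] cover cardG Ea Ec.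
have U := uniq_cover cover cardG.
have [|| _ _ _ ama mma] := @mP a; try by neq_from U.
have [|| _ _ _ cmc mmc] := @mP c; try by neq_from U.
have [|| mep meq mee eme mme] := @mP e; try by neq_from U.
rewrite Ea in ama mma; rewrite Ec in cmc mmc.
have := cover (m e); rewrite !inE (negPf mep) (negPf meq) (negPf mee) /=.
case/or4P=> [/eqP Ee|/eqP Ee|/eqP Ee|/orP[]/eqP Ee].
- by rewrite Ee Ea in mme; clash mme U.
- by rewrite Ee mma in mme; clash mme U.
- by rewrite Ee Ec in mme; clash mme U.
- by rewrite Ee mmc in mme; clash mme U.
rewrite Ee in eme.
apply: (iso_edge_list (x0 := p) (l := [:: p; a; b; q; e; f; c; d])) => //.
  by cover_from cover.
by check_edges.
Qed.

(** The remaining [c] and [f] must be matched, so three paths of length 3 run from [p] to [q]. *)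
Lemma iso_theta333 a b c d e f :
  all (sedge p) [:: a; b; c] -> all (sedge q) [:: d; e; f] ->
  (forall x, x \in [:: p; q; a; b; c; d; e; f]) -> #|G| = 8 ->
  m a = d -> m b = e -> iso G (theta 3 3 3).
Proof.
move=> /and4P[pa pb pc _] /and4P[qd qe qf _] cover cardG Ea Eb.
have U := uniq_cover cover cardG.
have [|| _ _ _ ama mma] := @mP a; try by neq_from U.
have [|| _ _ _ bmb mmb] := @mP b; try by neq_from U.
have [|| mcp mcq mcc cmc mmc] := @mP c; try by neq_from U.
rewrite Ea in ama mma; rewrite Eb in bmb mmb.
have := cover (m c); rewrite !inE (negPf mcp) (negPf mcq) (negPf mcc) /=.
case/or4P=> [/eqP Ec|/eqP Ec|/eqP Ec|/orP[]/eqP Ec].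
- by rewrite Ec Ea in mmc; clash mmc U.
- by rewrite Ec Eb in mmc; clash mmc U.
- by rewrite Ec mma in mmc; clash mmc U.
- by rewrite Ec mmb in mmc; clash mmc U.
rewrite Ec in cmc.
apply: (iso_edge_list (x0 := p) (l := [:: p; q; a; d; b; e; c; f])) => //.
  by cover_from cover.
by check_edges.
Qed.

(** With [a] and [b] matched, [c] has to cross to a neighbour of [q]; relabelling makes that
    neighbour [d]. *)
Lemma iso_dumbbell3_inner a b c d e f :
  all (sedge p) [:: a; b; c] -> all (sedge q) [:: d; e; f] ->
  (forall x, x \in [:: p; q; a; b; c; d; e; f]) -> #|G| = 8 ->
  m a = b -> iso G (dumbbell 3).
Proof.
move=> pabc qdef cover cardG Ea.
have /and4P[qd qe qf _] := qdef.
have U := uniq_cover cover cardG.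
have [|| _ _ _ _ mma] := @mP a; try by neq_from U.
have [|| mcp mcq mcc _ mmc] := @mP c; try by neq_from U.
rewrite Ea in mma.
have := cover (m c); rewrite !inE (negPf mcp) (negPf mcq) (negPf mcc) /=.
case/or4P=> [/eqP Ec|/eqP Ec|/eqP Ec|/orP[]/eqP Ec].
- by rewrite Ec Ea in mmc; clash mmc U.
- by rewrite Ec mma in mmc; clash mmc U.
- exact: (iso_dumbbell3 pabc qdef cover).
- apply: (iso_dumbbell3 pabc (_ : all _ [:: e; d; f])) Ea Ec => //.
    by rewrite /= qd qe qf.
  by cover_from cover.
- apply: (iso_dumbbell3 pabc (_ : all _ [:: f; d; e])) Ea Ec => //.
    by rewrite /= qd qe qf.
  by cover_from cover.
Qed.

(** The partner of [b] decides: [c] gives an inner pair next to [p], and a neighbour of [q] gives a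
    second crossing pair. *)
Lemma classify_cross a b c d e f :
  all (sedge p) [:: a; b; c] -> all (sedge q) [:: d; e; f] ->
  (forall x, x \in [:: p; q; a; b; c; d; e; f]) -> #|G| = 8 ->
  m a = d -> iso G (dumbbell 3) \/ iso G (theta 3 3 3).
Proof.
move=> pabc qdef cover cardG Ea.
have /and4P[pa pb pc _] := pabc; have /and4P[qd qe qf _] := qdef.
have U := uniq_cover cover cardG.
have [|| _ _ _ _ mma] := @mP a; try by neq_from U.
have [|| mbp mbq mbb _ mmb] := @mP b; try by neq_from U.
rewrite Ea in mma.
have := cover (m b); rewrite !inE (negPf mbp) (negPf mbq) (negPf mbb) /=.
case/or4P=> [/eqP Eb|/eqP Eb|/eqP Eb|/orP[]/eqP Eb].
- by rewrite Eb Ea in mmb; clash mmb U.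
- left; apply: (iso_dumbbell3_inner (_ : all _ [:: b; c; a]) qdef) Eb => //.
    by rewrite /= pa pb pc.
  by cover_from cover.
- by rewrite Eb mma in mmb; clash mmb U.
- by right; apply: iso_theta333 pabc qdef cover cardG Ea Eb.
- right; apply: (iso_theta333 pabc (_ : all _ [:: d; f; e])) Ea Eb => //.
    by rewrite /= qd qe qf.
  by cover_from cover.
Qed.

(** Up to relabelling, the partner of [a] is [b] or [d]. *)
Lemma classify_nonadjacent a b c d e f :
  all (sedge p) [:: a; b; c] -> all (sedge q) [:: d; e; f] ->
  (forall x, x \in [:: p; q; a; b; c; d; e; f]) -> #|G| = 8 ->
  iso G (dumbbell 3) \/ iso G (theta 3 3 3).
Proof.
move=> pabc qdef cover cardG.
have /and4P[pa pb pc _] := pabc; have /and4P[qd qe qf _] := qdef.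
have U := uniq_cover cover cardG.
have [|| map maq maa _ _] := @mP a; try by neq_from U.
have := cover (m a); rewrite !inE (negPf map) (negPf maq) (negPf maa) /=.
case/or4P=> [/eqP Ea|/eqP Ea|/eqP Ea|/orP[]/eqP Ea].
- by left; apply: iso_dumbbell3_inner pabc qdef cover cardG Ea.
- left; apply: (iso_dumbbell3_inner (_ : all _ [:: a; c; b]) qdef) Ea => //.
    by rewrite /= pa pb pc.
  by cover_from cover.
- exact: classify_cross pabc qdef cover cardG Ea.
- apply: (classify_cross pabc (_ : all _ [:: e; d; f])) Ea => //.
    by rewrite /= qd qe qf.
  by cover_from cover.
- apply: (classify_cross pabc (_ : all _ [:: f; d; e])) Ea => //.
    by rewrite /= qd qe qf.
  by cover_from cover.
Qed.

End Mate.

Lemma classify_one : iso G (dumbbell 1) \/ iso G (dumbbell 3) \/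
  iso G (theta 3 3 1) \/ iso G (theta 3 3 3).
Proof.
have [m mP] := mate; have [sp [sq [+ + psp qsq [U cover]]]] := nbr_lists.
have cardG := card_cover U cover; have [epq|_] := boolP (sedge p q).
  case: sp psp U cover {cardG} => [|a [|b []]] //= psp U cover _.
  case: sq qsq U cover => [|c [|d []]] //= qsq U cover _.
  by have [] := classify_adjacent mP epq psp qsq cover U; auto.
case: sp psp {U} cover cardG => [|a [|b [|c []]]] //= psp cover cardG _.
case: sq qsq cover cardG => [|d [|e [|f []]]] //= qsq cover cardG _.
by have [] := classify_nonadjacent mP psp qsq cover cardG; auto.
Qed.

End ExactlyOne.

(* Every degree-2 vertex has as many neighbours of degree 3 as one next to [p],
   that is one or two. *)
Lemma classify_degree3 :
  iso G (dumbbell 1) \/ iso G (dumbbell 3) \/ iso G (theta 2 2 1) \/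
  iso G (theta 3 3 1) \/ iso G (theta 2 2 2) \/ iso G (theta 3 3 3).
Proof.
have [x] : exists x, x \in [set x | sedge p x] :\ q.
  by apply/card_gt0P; rewrite card_nbr_p; case: sedge.
rewrite !inE => /andP[xq px].
have xp : x != p by rewrite eq_sym sedge_neq.
have same y : y != p -> y != q -> sedge p y + sedge q y = 1 + sedge q x.
  move=> yp yq; have := ddG (etrans (d2 yp yq) (esym (d2 xp xq))).
  by rewrite !nbr_deg_sum_degree2 // px => /addnI.
have [qx|nqx] := boolP (sedge q x).
  have both y : y != p -> y != q -> sedge p y && sedge q y.
    by move=> yp yq; have := same y yp yq; rewrite qx; do 2!case: sedge.
  by case: (classify_both both); auto 7.
have one y : y != p -> y != q -> sedge p y = ~~ sedge q y.
  by move=> yp yq; have := same y yp yq; rewrite (negPf nqx); do 2!case: sedge.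
by case: (classify_one one) => [|[|[]]]; auto 7.
Qed.

End TwoDegree3.
End Classification.

Theorem theorem2 (R : realType) (G : sgraph)
    (hbicyclic : bicyclic G) (hdelta : 1 < min_degree G) :
  exactly_two_main_signless_eigenvalues R G <->
  iso G bowtie \/ iso G (dumbbell 1) \/ iso G (dumbbell 3) \/
  iso G (theta 2 2 1) \/ iso G (theta 3 3 1) \/
  iso G (theta 2 2 2) \/ iso G (theta 3 3 3).
Proof.
have [_ edgesG] := hbicyclic; have profile := degree_profileP edgesG hdelta.
rewrite (two_main_degree_determined R profile); split=> [ddG|].
  case: profile => [w w4 d2|p q pq p3 q3 d2].
    by left; apply: classify_degree4 d2.
  by right; apply: classify_degree3 d2.
(* For each of the seven graphs the remaining condition is a closed boolean, settled by
   computation. *)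
by case=> [|[|[|[|[|[]]]]]] isoG; apply: (iso_degree_determined isoG);
  apply: edge_list_degree_determined.
Qed.
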